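(* Let $n\geq 1$ and let $\rho: C^\ast(Q_n) \to B(\mathcal{H})$ be an irreducible representation. Then there exists $\mathbf{t} \in \Delta_{n-1}$ such that $\rho$ is unitarily equivalent to a subrepresentation of $\rho_{\mathbf{t}}$ (i.e. to the restriction of $\rho_{\mathbf{t}}$ to some invariant subspace).
   Context: For $n \geq 1$, identify each integer $0 \le i < 2^n$ with its $n$-digit binary representation ($i = \sum_{k} i_k 2^k$), write $\mathrm{par}_k(i) = \sum_{\ell=0}^{k} i_\ell \bmod 2$, and let $i \# k$ be $i$ with its $k$-th binary digit flipped. The hypercube $Q_n$ has vertex sets $U_n = \{i<2^n \mid \mathrm{par}_{n-1}(i)=0\}$, $V_n=\{j<2^n\mid \mathrm{par}_{n-1}(j)=1\}$, with $i\in U_n$, $j\in V_n$ adjacent (edge $ij$) iff $j = i\#k$ for some $k<n$. $C^\ast(Q_n)$ is the universal unital C*-algebra generated by projections $p_x$ ($x\in U_n\cup V_n$) with $\sum_{u\in U_n}p_u = 1 = \sum_{v\in V_n}p_v$ and $p_up_v=0$ when $u\in U_n, v\in V_n$ are non-adjacent. $\Delta_{n-1}=\{[t_0,\dots,t_{n-1}]\mid t_k\ge 0,\sum t_k=1\}$. For $\mathbf{t}\in\Delta_{n-1}$ and an edge $ij$ ($i\in U_n$) with $j = i\#k$ put $c_{\mathbf{t}}(ij) = (-1)^{\mathrm{par}_k(i)}\sqrt{t_k}$, and set $c_{\mathbf t}(ij)=0$ if $i,j$ are not adjacent. Then $\rho_{\mathbf{t}}: C^\ast(Q_n)\to M_{U_n}=B(\mathbb{C}^{U_n})$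 is the representation with $\rho_{\mathbf t}(p_i) = E_{ii}$ for $i\in U_n$ and $\rho_{\mathbf t}(p_j) = \big[c_{\mathbf t}(i_1j)\overline{c_{\mathbf t}(i_2j)}\big]_{i_1,i_2\in U_n}$ (the projection onto the span of the unit vector $(c_{\mathbf t}(ij))_{i\in U_n}$) for $j \in V_n$. *)

(* Defs.v *)
From HB Require Import structures.
From mathcomp Require Import all_boot all_order all_algebra.
From mathcomp Require Import complex.
From mathcomp Require Import reals.
Set Implicit Arguments.
Unset Strict Implicit.
Unset Printing Implicit Defensive.
Import Order.TTheory GRing.Theory Num.Theory.
Local Open Scope ring_scope.

Definition bit (l i : nat) : bool := odd (i %/ 2 ^ l).

Definition par (k i : nat) : bool := odd (\sum_(l < k.+1) bit l i).

Definition flip (i k : nat) : nat :=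
  if bit k i then (i - 2 ^ k)%N else (i + 2 ^ k)%N.

Definition inU (n : nat) (i : 'I_(2 ^ n)) : bool := ~~ par n.-1 i.
Definition inV (n : nat) (j : 'I_(2 ^ n)) : bool := par n.-1 j.
Arguments inU : clear implicits.
Arguments inV : clear implicits.

Definition adj (n : nat) (i j : 'I_(2 ^ n)) : bool :=
  [exists k : 'I_n, (j : nat) == flip i k].

Definition Ut (n : nat) := {i : 'I_(2 ^ n) | inU n i}.

Section Hilbert.
Variable R : realType.
Local Notation C := R[i].
Variable H : lmodType C.
Variable ip : H -> H -> C.

Definition normsq (h : H) : R := complex.Re (ip h h).

Definition converges (u : nat -> H) (l : H) : Prop :=
  forall e : R, 0 < e -> exists N, forall m, (N <= m)%N -> normsq (u m - l) < e.

Definition cauchy (u : nat -> H) : Prop :=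
  forall e : R, 0 < e -> exists N, forall m k, (N <= m)%N -> (N <= k)%N ->
    normsq (u m - u k) < e.

Record is_hilbert : Prop := {
  ip_linear : forall (a : C) (x y z : H), ip (a *: x + y) z = a * ip x z + ip y z;
  ip_conj : forall x y : H, ip y x = conjc (ip x y);
  ip_pos : forall x : H, 0 <= complex.Re (ip x x);
  ip_definite : forall x : H, ip x x = 0 -> x = 0;
  ip_complete : forall u : nat -> H, cauchy u -> exists l, converges u l
}.

Definition is_projection (P : H -> H) : Prop :=
  (forall (a : C) (x y : H), P (a *: x + y) = a *: P x + P y) /\
  (forall x, P (P x) = P x) /\
  (forall x y, ip (P x) y = ip x (P y)).

Definition is_subspace (S : H -> Prop) : Prop :=
  S 0 /\ forall (a : C) x y, S x -> S y -> S (a *: x + y).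

Definition is_closed (S : H -> Prop) : Prop :=
  forall u l, (forall m, S (u m)) -> converges u l -> S l.
End Hilbert.

(* Representations of C*(Q_n) on H: by the universal property, these  *)
(* are exactly families of projections (p_x)_{x < 2^n} satisfying the   *)
(* defining relations.                                                  *)
Definition is_QnRep (R : realType) (n : nat) (H : lmodType R[i])
    (ip : H -> H -> R[i]) (p : 'I_(2 ^ n) -> H -> H) : Prop :=
  (forall x, is_projection ip (p x)) /\
  (forall h, \sum_(u : 'I_(2 ^ n) | inU n u) p u h = h) /\
  (forall h, \sum_(v : 'I_(2 ^ n) | inV n v) p v h = h) /\
  (forall u v, inU n u -> inV n v -> ~~ adj u v -> forall h, p u (p v h) = 0).

Definition is_irreducible (R : realType) (n : nat) (H : lmodType R[i])
    (ip : H -> H -> R[i]) (p : 'I_(2 ^ n) -> H -> H) : Prop :=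
  (exists h : H, h <> 0) /\
  forall S : H -> Prop, is_subspace S -> is_closed ip S ->
    (forall x h, S h -> S (p x h)) ->
    (forall h, S h -> h = 0) \/ (forall h, S h).

(* c_t(ij) for i in U_n (as a number), j a vertex *)
Definition ct (R : realType) (n : nat) (t : 'I_n -> R) (i j : nat) : R[i] :=
  match [pick k : 'I_n | j == flip i k] with
  | Some k => (-1) ^+ par k i * real_complex R (Num.sqrt (t k))
  | None => 0
  end.

Definition vecU (R : realType) (n : nat) := Ut n -> R[i].

Definition rho_t (R : realType) (n : nat) (t : 'I_n -> R) (x : 'I_(2 ^ n))
    (f : vecU R n) : vecU R n :=
  if inU n x then
    fun i1 => if val i1 == x then f i1 else 0
  else
    (* [c(i1 x) conj(c(i2 x))]_{i1,i2} *)
    fun i1 => ct t (val i1) x *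
              \sum_(i2 : Ut n) conjc (ct t (val i2) x) * f i2.

Definition ipU (R : realType) (n : nat) (f g : vecU R n) : R[i] :=
  \sum_(i : Ut n) f i * conjc (g i).

(* Main.v *)
(* Let X_k be the sum over u in U_n of p_{u#k} p_u.  The relations give
   sum_k X_k = 1, X_k^* X_l = - X_l^* X_k and X_k X_l^* = - X_l X_k^* for k <> l,
   whence X_k + X_k^* = 2 X_k^* X_k = 2 X_k X_k^*.  The operator X_k^* X_k commutes
   with all p_x, so by Schur's lemma it is a scalar t_k >= 0, and sum_k t_k = 1.
   Normalising by sqrt (t_k) turns the X_k into isometries between the ranges of
   p_x and p_{x#k} that satisfy Clifford relations.  Starting from a unit vector in
   one range, averaging over the resulting commuting involutions gives vectors e_x
   in the range of p_x on which the p_y act by the coefficients c_t; the vectors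
   orthogonal to all e_u (u in U_n) form a proper closed invariant subspace, which
   is zero by irreducibility, so the nonzero e_u form an orthonormal basis.

   Schur's lemma uses a spectral decomposition only through sqrt (T^2), obtained
   as the norm limit of Y_{m+1} = (1 - T^2 + Y_m^2) / 2. *)
Require Import Defs.
From HB Require Import structures.
From mathcomp Require Import all_boot all_order all_algebra.
From mathcomp Require Import complex.
From mathcomp Require Import classical_sets boolp reals.
From mathcomp Require Import zify ring lra.
Set Implicit Arguments.
Unset Strict Implicit.
Unset Printing Implicit Defensive.
Import Order.TTheory GRing.Theory Num.Theory.
Local Open Scope ring_scope.

(** * Bits and the hypercube *)

Lemma bitS l i : bit l.+1 i = bit l i./2.
Proof. by rewrite /bit expnS divnMA divn2. Qed.

Lemma bit_ge k i : bit k i -> (2 ^ k <= i)%N.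
Proof. by rewrite leqNgt; apply: contraL => h; rewrite /bit divn_small. Qed.

(** Induction on a common bound: the lowest bit fixes the parity, and halving shifts the remaining
    bits. *)
Lemma bit_inj i j : (forall l, bit l i = bit l j) -> i = j.
Proof.
have [m lim ljm] : exists2 m, (i <= m)%N & (j <= m)%N by exists (i + j)%N; lia.
elim: m i j lim ljm => [|m IH] i j lim ljm eqb; first by lia.
have odd_eq : odd i = odd j by have := eqb 0; rewrite /bit expn0 !divn1.
have half_eq : i./2 = j./2 by apply: IH => [||l]; rewrite -?bitS //; lia.
by rewrite -(odd_double_half i) -(odd_double_half j) odd_eq half_eq.
Qed.

Lemma flip0 i : flip i 0 = (~~ odd i + i./2.*2)%N.
Proof. by rewrite /flip /bit expn0 divn1; have := odd_double_half i; case: odd; lia. Qed.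

Lemma flipS i k : flip i k.+1 = (odd i + (flip i./2 k).*2)%N.
Proof.
rewrite /flip bitS expnS; have := odd_double_half i.
by case: ifPn => [/bit_ge|_]; lia.
Qed.

Lemma bit_flip l i k : bit l (flip i k) = bit l i (+) (l == k).
Proof.
elim: k l i => [|k IH] [|l] i; rewrite ?flip0 ?flipS ?bitS.
- by rewrite /bit expn0 !divn1 oddD odd_double addbF oddb; case: odd.
- by rewrite half_bit_double addbF.
- by rewrite /bit expn0 !divn1 oddD odd_double addbF oddb; case: odd.
- by rewrite half_bit_double IH.
Qed.

Lemma flipK k : involutive (flip ^~ k).
Proof. by move=> i; apply: bit_inj => l; rewrite !bit_flip addbK. Qed.

Lemma flipC i k l : flip (flip i k) l = flip (flip i l) k.
Proof. by apply: bit_inj => m; rewrite !bit_flip addbAC. Qed.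

Lemma flip_inj i : injective (flip i).
Proof.
move=> k l /(congr1 (bit k)); rewrite !bit_flip eqxx => /addbI.
by move/esym/eqP.
Qed.

Lemma par_flip m i k : par m (flip i k) = par m i (+) (k <= m)%N.
Proof.
have parE j : par m j = \big[addb/false]_(l < m.+1) bit l j.
  by rewrite /par (big_morph odd oddD (erefl : odd 0 = false)); apply: eq_bigr => l _; case: bit.
rewrite !parE (eq_bigr (fun l : 'I__ => bit l i (+) (val l == k))); last by move=> l _; rewrite bit_flip.
rewrite big_split /=; congr (_ (+) _).
case: (leqP k m) => km.
  rewrite (bigD1 (Ordinal (km : (k < m.+1)%N))) //= eqxx big1 // => j; apply: contraNF => /eqP e.
  by apply/eqP/val_inj.
rewrite big1 // => j _; apply/negbTE; have := ltn_ord j; lia.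
Qed.

Lemma flip_lt n i k : (k < n)%N -> (i < 2 ^ n)%N -> (flip i k < 2 ^ n)%N.
Proof.
elim: n k i => // n IH [|k] i kn lin; rewrite ?flip0 ?flipS.
  by move: lin; rewrite expnS; have := odd_double_half i; case: odd; lia.
have : (i./2 < 2 ^ n)%N by move: lin; rewrite expnS; have := odd_double_half i; lia.
by move/(IH k i./2 kn); rewrite expnS; case: odd; lia.
Qed.

Section Hypercube.
Variable n : nat.
Implicit Types (i j x y : 'I_(2 ^ n)) (k l : 'I_n).

Definition flipo x k : 'I_(2 ^ n) := Ordinal (@flip_lt n x k (ltn_ord k) (ltn_ord x)).

(* The side of the bipartition: [false] on U_n, [true] on V_n. *)
Definition cls x : bool := par n.-1 x.

Lemma flipoK k : involutive (flipo ^~ k).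
Proof. by move=> x; apply/val_inj/flipK. Qed.

Lemma flipoC x k l : flipo (flipo x k) l = flipo (flipo x l) k.
Proof. exact/val_inj/flipC. Qed.

Lemma flipo_inj x : injective (flipo x).
Proof. by move=> k l [] /flip_inj/val_inj. Qed.

Lemma cls_flipo x k : cls (flipo x k) = ~~ cls x.
Proof.
have kn : (k <= n.-1)%N by have := ltn_ord k; lia.
by rewrite /cls par_flip kn addbT.
Qed.

Lemma adjP x y : reflect (exists k, y = flipo x k) (adj x y).
Proof.
apply: (iffP existsP) => -[k] => [/eqP e|->]; exists k; last exact/eqP.
exact/val_inj.
Qed.

Lemma adj_sym x y : adj x y = adj y x.
Proof. by apply/adjP/adjP => -[k ->]; exists k; rewrite flipoK. Qed.

(** If y = x#m and y#m' = x#k#l, comparing bits gives {m, m'} = {k, l}; for m = m' the two flips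
    would cancel, contradicting k <> l. *)
Lemma common_nbr x k l y : k != l -> adj x y -> adj y (flipo (flipo x k) l) ->
  (y == flipo x k) || (y == flipo x l).
Proof.
move=> kl /adjP[m ->] /adjP[m' /(congr1 val)/= e].
have eqb q : (q == k :> nat) (+) (q == l :> nat) = (q == m :> nat) (+) (q == m' :> nat).
  by have := congr1 (bit q) e; rewrite !bit_flip -!addbA => /addbI.
rewrite !(inj_eq (@flipo_inj x)).
have := eqb m; rewrite eqxx -!val_eqE /=.
case: (eqVneq (m : nat) m') => [mm|mm]; last by case: (_ == _).
have := eqb k; have : (k : nat) != l by [].
by rewrite mm eqxx => /negbTE ->; case: (_ == _).
Qed.

End Hypercube.

(** * Hilbert spaces *)

Definition mklinear {K : pzRingType} {V W : lmodType K} (f : V -> W) (fL : linear f) :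
    {linear V -> W} :=
  HB.pack f (@GRing.isLinear.Build K V W *:%R f fL).

Section HilbertFacts.
Variables (R : realType) (H : lmodType R[i]) (ip : H -> H -> R[i]).
Hypothesis hH : is_hilbert ip.
Local Notation "r %:C" := (real_complex R r) : ring_scope.
Local Notation normsq := (normsq ip).
Local Notation converges := (converges ip).
Implicit Types (x y z h : H) (u v : nat -> H) (a : R[i]) (r c e : R).

Lemma ip0l x : ip 0 x = 0.
Proof.
have := ip_linear hH 1 0 0 x; rewrite scaler0 addr0 mul1r => /eqP.
by rewrite -subr_eq0 opprD addNKr oppr_eq0 => /eqP.
Qed.

Lemma ipDl x y z : ip (x + y) z = ip x z + ip y z.
Proof. by have := ip_linear hH 1 x y z; rewrite scale1r mul1r. Qed.

Lemma ipZl a x z : ip (a *: x) z = a * ip x z.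
Proof. by have := ip_linear hH a x 0 z; rewrite !addr0 ip0l addr0. Qed.

Lemma ipNl x z : ip (- x) z = - ip x z.
Proof. by rewrite -scaleN1r ipZl mulN1r. Qed.

Lemma ip_suml (I : finType) (P : pred I) (F : I -> H) z :
  ip (\sum_(i | P i) F i) z = \sum_(i | P i) ip (F i) z.
Proof. by apply: (big_morph (ip ^~ z)) => [x y|]; [exact: ipDl | exact: ip0l]. Qed.

Lemma ip0r x : ip x 0 = 0.
Proof. by rewrite (ip_conj hH) ip0l conjc0. Qed.

Lemma ipDr x y z : ip x (y + z) = ip x y + ip x z.
Proof. by rewrite (ip_conj hH) ipDl rmorphD /= -!(ip_conj hH). Qed.

Lemma ipZr a x z : ip x (a *: z) = conjc a * ip x z.
Proof. by rewrite (ip_conj hH) ipZl rmorphM /= -(ip_conj hH). Qed.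

Lemma ipNr x z : ip x (- z) = - ip x z.
Proof. by rewrite -scaleN1r ipZr rmorphN rmorph1 mulN1r. Qed.

Lemma ip_sumr (I : finType) (P : pred I) (F : I -> H) z :
  ip z (\sum_(i | P i) F i) = \sum_(i | P i) ip z (F i).
Proof. by apply: (big_morph (ip z)) => [x y|]; [exact: ipDr | exact: ip0r]. Qed.

Lemma ip_selfE x : ip x x = (normsq x)%:C.
Proof.
have := ip_conj hH x x; rewrite /Defs.normsq; case: (ip x x) => a b [] /= /eqP.
by rewrite -subr_eq0 opprK -mulr2n mulrn_eq0 /= => /eqP ->.
Qed.

Lemma ip_ext x y : (forall z, ip x z = ip y z) -> x = y.
Proof.
move=> xy; apply/subr0_eq/(ip_definite hH).
by rewrite ipDl ipNl xy subrr.
Qed.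

Definition ipE := (ipDl, ipNl, ipZl).

(** * The underlying real inner product and its norm *)

Definition re_ip x y : R := complex.Re (ip x y).

Lemma re_sym x y : re_ip x y = re_ip y x.
Proof. by rewrite /re_ip (ip_conj hH x y); case: (ip x y). Qed.

Lemma reDl x y z : re_ip (x + y) z = re_ip x z + re_ip y z.
Proof. by rewrite /re_ip ipDl; case: (ip x z); case: (ip y z). Qed.

Lemma reNl x z : re_ip (- x) z = - re_ip x z.
Proof. by rewrite /re_ip ipNl; case: (ip x z). Qed.

Lemma reZl r x z : re_ip (r%:C *: x) z = r * re_ip x z.
Proof. by rewrite /re_ip ipZl; case: (ip x z) => a b /=; rewrite mul0r subr0. Qed.

Lemma reDr x y z : re_ip z (x + y) = re_ip z x + re_ip z y.
Proof. by rewrite !(re_sym z) reDl. Qed.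

Lemma reNr x z : re_ip z (- x) = - re_ip z x.
Proof. by rewrite !(re_sym z) reNl. Qed.

Lemma reZr r x z : re_ip z (r%:C *: x) = r * re_ip z x.
Proof. by rewrite !(re_sym z) reZl. Qed.

Lemma re_suml (I : finType) (P : pred I) (F : I -> H) z :
  re_ip (\sum_(i | P i) F i) z = \sum_(i | P i) re_ip (F i) z.
Proof.
apply: (big_morph (re_ip ^~ z)) => [x y|]; first exact: reDl.
by rewrite /re_ip ip0l.
Qed.

Definition reE := (reDl, reDr, reNl, reNr, reZl, reZr).

Lemma normsqE x : normsq x = re_ip x x. Proof. by []. Qed.

Lemma normsq_ge0 x : 0 <= normsq x. Proof. exact: ip_pos hH x. Qed.

Lemma normsq_eq0 x : normsq x = 0 -> x = 0.
Proof. by move=> h; apply: (ip_definite hH); rewrite ip_selfE h. Qed.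

Lemma normsqN x : normsq (- x) = normsq x.
Proof. by rewrite !normsqE !reE opprK. Qed.

Lemma normsqB x y : normsq (x - y) = normsq (y - x).
Proof. by rewrite -normsqN opprB. Qed.

Lemma normsqZ r x : normsq (r%:C *: x) = r ^+ 2 * normsq x.
Proof. by rewrite !normsqE !reE; ring. Qed.

Lemma normsqD_le x y : normsq (x + y) <= 2 * normsq x + 2 * normsq y.
Proof.
have := normsq_ge0 (x - y); rewrite !normsqE !reE (re_sym y x); lra.
Qed.

Lemma cauchy_schwarz x y : re_ip x y ^+ 2 <= normsq x * normsq y.
Proof.
have [y0|yn0] := eqVneq (normsq y) 0.
  by rewrite y0 mulr0 (normsq_eq0 y0) /re_ip ip0r /= expr0n.
have yp : 0 < normsq y by rewrite lt_def yn0 normsq_ge0.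
have := normsq_ge0 ((normsq y)%:C *: x - (re_ip x y)%:C *: y).
rewrite normsqE !reE (re_sym y x) -!normsqE => h.
have : 0 <= normsq y * (normsq x * normsq y - re_ip x y ^+ 2) by lra.
by rewrite pmulr_rge0 // subr_ge0.
Qed.

Definition norm_ip x : R := Num.sqrt (normsq x).

Lemma nrm_ge0 x : 0 <= norm_ip x. Proof. exact: sqrtr_ge0. Qed.

Lemma nrm_sq x : norm_ip x ^+ 2 = normsq x.
Proof. by rewrite sqr_sqrtr ?normsq_ge0. Qed.

Lemma re_le_nrm x y : re_ip x y <= norm_ip x * norm_ip y.
Proof.
rewrite -sqrtrM ?normsq_ge0 //; apply: le_trans (ler_norm _) _.
by rewrite -sqrtr_sqr ler_sqrt ?cauchy_schwarz // mulr_ge0 ?normsq_ge0.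
Qed.

Lemma nrmD x y : norm_ip (x + y) <= norm_ip x + norm_ip y.
Proof.
rewrite -(@ler_pXn2r _ 2) ?nnegrE ?addr_ge0 ?nrm_ge0 //.
rewrite nrm_sq sqrrD !nrm_sq !normsqE !reE (re_sym y x).
by have := re_le_nrm x y; lra.
Qed.

Lemma nrmZ r x : norm_ip (r%:C *: x) = `|r| * norm_ip x.
Proof. by rewrite /norm_ip normsqZ sqrtrM ?sqr_ge0 // sqrtr_sqr. Qed.

Lemma nrm_le_normsq (c : R) x y : 0 <= c -> norm_ip x <= c * norm_ip y -> normsq x <= c ^+ 2 * normsq y.
Proof.
by move=> c0; rewrite -!nrm_sq -exprMn ler_pXn2r // nnegrE ?mulr_ge0 ?nrm_ge0.
Qed.

Lemma normsq_le_nrm x y : normsq x <= normsq y -> norm_ip x <= norm_ip y.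
Proof. by move=> h; rewrite /norm_ip ler_sqrt ?normsq_ge0. Qed.

(** * Limits of sequences *)

Lemma le_eps0 r : (forall e, 0 < e -> r <= e) -> r <= 0.
Proof.
move=> h; rewrite leNgt; apply/negP => r0.
by have : r <= r / 2; [apply: h|]; lra.
Qed.

Lemma converges_unique u l l' : converges u l -> converges u l' -> l = l'.
Proof.
move=> cl cl'; apply/subr0_eq/normsq_eq0/le_anti; rewrite normsq_ge0 andbT.
(* The 4 absorbs the factors 2 of [normsqD_le], which replaces the triangle inequality for squared
   norms. *)
apply: le_eps0 => e e0; have e4 : 0 < e / 4 by lra.
have [N hN] := cl _ e4; have [N' hN'] := cl' _ e4.
have := hN (maxn N N') (leq_maxl _ _); have := hN' (maxn N N') (leq_maxr _ _).
have := normsqD_le (l - u (maxn N N')) (u (maxn N N') - l').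
rewrite addrA subrK [normsq (l - _)]normsqB; lra.
Qed.

Lemma convergesD u v l l' : converges u l -> converges v l' ->
  converges (fun m => u m + v m) (l + l').
Proof.
move=> cl cl' e e0; have e4 : 0 < e / 4 by lra.
have [N hN] := cl _ e4; have [N' hN'] := cl' _ e4.
exists (maxn N N') => m; rewrite geq_max => /andP[/hN h /hN' h'].
by have := normsqD_le (u m - l) (v m - l'); rewrite addrACA -opprD; lra.
Qed.

Lemma converges_bounded (f : {linear H -> H}) C u l :
  (forall x, normsq (f x) <= C * normsq x) -> converges u l ->
  converges (fun m => f (u m)) (f l).
Proof.
(* Dividing by |C| + 1 instead of C keeps the divisor positive. *)
move=> fC cl e e0; have C0 : 0 < `|C| + 1 by have := normr_ge0 C; lra.
have [N hN] := cl _ (divr_gt0 e0 C0).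
exists N => m /hN; rewrite ltr_pdivlMr // -linearB /= => h.
have := fC (u m - l); have := normsq_ge0 (u m - l); have := ler_norm C; nra.
Qed.

Lemma converges_cst l : converges (fun=> l) l.
Proof. by move=> e e0; exists 0 => m _; rewrite subrr /Defs.normsq ip0l. Qed.

Lemma normsq_scale_le a x : normsq (a *: x) <= (complex.Re a ^+ 2 + complex.Im a ^+ 2) * normsq x.
Proof.
rewrite {1}/Defs.normsq ipZl ipZr ip_selfE; case: a => a b /=.
lra.
Qed.

Lemma convergesZ a u l : converges u l -> converges (fun m => a *: u m) (a *: l).
Proof.
exact: (@converges_bounded ( *:%R a) _ u l (normsq_scale_le a)).
Qed.

(** Orthogonal complements are closed: testing against y gives the real part, against i y the
    imaginary part. *)
Lemma converges_ip0 u l y :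
  (forall m, ip (u m) y = 0) -> converges u l -> ip l y = 0.
Proof.
move=> uy cl.
have re0 z : (forall m, re_ip (u m) z = 0) -> re_ip l z = 0.
  move=> uz; apply/eqP; rewrite -sqrf_eq0; apply/eqP/le_anti; rewrite sqr_ge0 andbT.
  apply: le_eps0 => e e0; have nz := normsq_ge0 z.
  have d0 : 0 < e / (normsq z + 1) by rewrite divr_gt0 //; lra.
  have [N /(_ N (leqnn N))] := cl _ d0.
  rewrite ltr_pdivlMr; last lra.
  have := cauchy_schwarz (l - u N) z; rewrite reDl reNl uz oppr0 addr0 normsqB.
  have := normsq_ge0 (u N - l); nra.
have := re0 y; have := re0 ('i%C *: y); rewrite /re_ip ipZr.
case: (ip l y) => a b /= imz rez; congr (_ +i* _)%C.
  by apply: rez => m; rewrite uy.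
have : 0 * a - - 1 * b = 0 by apply: imz => m; rewrite ipZr uy mulr0.
lra.
Qed.

Lemma converges_nrm_le u l C : (forall m, norm_ip (u m) <= C) -> converges u l -> norm_ip l <= C.
Proof.
move=> uC cl; rewrite -subr_le0; apply: le_eps0 => e e0.
have [N hN] := cl _ (exprn_gt0 2 e0).
have := hN N (leqnn N); rewrite -nrm_sq ltr_pXn2r ?nnegrE ?nrm_ge0 ?(ltW e0) // => h.
have := nrmD (u N) (l - u N); rewrite addrC subrK /norm_ip [normsq (l - _)]normsqB -!/(norm_ip _).
by have := uC N; lra.
Qed.

End HilbertFacts.

(** * Square roots and Schur's lemma *)

Section SqrtIteration.
Variables (R : realType) (H : lmodType R[i]) (ip : H -> H -> R[i]).
Hypothesis hH : is_hilbert ip.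
Local Notation "r %:C" := (real_complex R r) : ring_scope.
Local Notation normsq := (normsq ip).
Local Notation nrm := (norm_ip ip).
Local Notation converges := (converges ip).
Variable X : {linear H -> H}.
Hypothesis X_le : forall h, normsq (X h) <= normsq h.

(** Y_{m+1} = (X + Y_m^2) / 2 with Y_0 = 0, so that a limit Y satisfies (1 - Y)^2 = 1 - X. *)
Fixpoint sqrt_iter m (h : H) : H :=
  if m is k.+1 then (2^-1)%:C *: (X h + sqrt_iter k (sqrt_iter k h)) else 0.

(** The same iteration at the scalar X = 1; it majorises the operator iteration of a contraction. *)
Fixpoint sqrt_bound m : R := if m is k.+1 then 2^-1 * (1 + sqrt_bound k ^+ 2) else 0.

Lemma sqrt_iter_linear m : linear (sqrt_iter m).
Proof.
elim: m => [|m IH] a x y /=; first by rewrite scaler0 addr0.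
rewrite !IH linearP scalerA mulrC -scalerA -scalerDr; congr (_ *: _).
by rewrite scalerDr addrACA.
Qed.

HB.instance Definition _ m :=
  @GRing.isLinear.Build _ _ _ _ (sqrt_iter m) (sqrt_iter_linear m).

Lemma sqrt_iter_comm (B : {linear H -> H}) m h :
  (forall h, B (X h) = X (B h)) -> B (sqrt_iter m h) = sqrt_iter m (B h).
Proof.
move=> BX; elim: m h => [|m IH] h /=; first by rewrite linear0.
by rewrite linearZ linearD /= BX !IH.
Qed.

Lemma sqrt_iterC m k h : sqrt_iter m (sqrt_iter k h) = sqrt_iter k (sqrt_iter m h).
Proof.
apply: (@sqrt_iter_comm (sqrt_iter m)) => {}h.
by apply/esym/sqrt_iter_comm.
Qed.

Lemma sqrt_bound_itv m : 0 <= sqrt_bound m <= 1.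
Proof. by elim: m => [|m /andP[a b]] /=; apply/andP; split; nra. Qed.

Lemma sqrt_bound_le k m : (k <= m)%N -> sqrt_bound k <= sqrt_bound m.
Proof.
elim: k m => [|k IH] [|m] //= km; first by have /andP[] := sqrt_bound_itv m.+1.
have := IH _ km; have /andP[] := sqrt_bound_itv k; have /andP[] := sqrt_bound_itv m; nra.
Qed.

Lemma sqrt_iter_le m h : nrm (sqrt_iter m h) <= sqrt_bound m * nrm h.
Proof.
elim: m h => [|m IH] h /=; first by rewrite /norm_ip /Defs.normsq ip0l //= sqrtr0 mul0r.
rewrite nrmZ // ger0_norm ?invr_ge0 //.
have := nrmD hH (X h) (sqrt_iter m (sqrt_iter m h)).
have := normsq_le_nrm hH (X_le h).
have := IH (sqrt_iter m h); have := IH h; have /andP[] := sqrt_bound_itv m.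
have := nrm_ge0 ip h; nra.
Qed.

(** The iterates commute, so Y_m^2 - Y_k^2 = (Y_m + Y_k)(Y_m - Y_k), and the bound passes to the
    next index exactly as for the scalars. *)
Lemma sqrt_iter_diff k m h : (k <= m)%N ->
  nrm (sqrt_iter m h - sqrt_iter k h) <= (sqrt_bound m - sqrt_bound k) * nrm h.
Proof.
have base j x : nrm (sqrt_iter j x - sqrt_iter 0 x) <= (sqrt_bound j - sqrt_bound 0) * nrm x.
  by rewrite !subr0 sqrt_iter_le.
elim: m k h => [|m IH] [|k] h // km; try exact: base.
rewrite /= -scalerBr opprD addrACA subrr add0r.
have -> : sqrt_iter m (sqrt_iter m h) - sqrt_iter k (sqrt_iter k h) =
   sqrt_iter m (sqrt_iter m h - sqrt_iter k h) + sqrt_iter k (sqrt_iter m h - sqrt_iter k h).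
  by rewrite !linearB /= (sqrt_iterC k m) addrA subrK.
rewrite nrmZ // ger0_norm ?invr_ge0 //.
set g := sqrt_iter m h - _.
have := nrmD hH (sqrt_iter m g) (sqrt_iter k g).
have := sqrt_iter_le m g; have := sqrt_iter_le k g.
have : nrm g <= (sqrt_bound m - sqrt_bound k) * nrm h by exact: IH.
have := nrm_ge0 ip g; have := nrm_ge0 ip h.
have /andP[] := sqrt_bound_itv m; have /andP[] := sqrt_bound_itv k.
nra.
Qed.

(** The scalar bounds increase and stay below 1; once they are close to their supremum,
    [sqrt_iter_diff] makes the differences small. *)
Lemma sqrt_iter_cauchy h : cauchy ip (sqrt_iter^~ h).
Proof.
move=> e e0.
pose E := [set r | exists m, r = sqrt_bound m]%classic.
have supE : has_sup E.
  split; first by exists (sqrt_bound 0); exists 0.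
  by exists 1 => _ [m ->]; have /andP[] := sqrt_bound_itv m.
have d0 : 0 < Num.sqrt e / (nrm h + 1).
  by rewrite divr_gt0 ?sqrtr_gt0 //; have := nrm_ge0 ip h; lra.
have [_ [N ->] hN] := sup_adherent d0 supE.
have ub m : sqrt_bound m <= sup E by apply: sup_upper_bound => //; exists m.
have key m k : (N <= k)%N -> (k <= m)%N -> normsq (sqrt_iter m h - sqrt_iter k h) < e.
  move=> Nk km; rewrite -nrm_sq // -(sqr_sqrtr (ltW e0)).
  rewrite ltr_pXn2r ?nnegrE ?nrm_ge0 ?sqrtr_ge0 //.
  apply: le_lt_trans (sqrt_iter_diff h km) _.
  have lt : sqrt_bound m - sqrt_bound k < Num.sqrt e / (nrm h + 1).
    by have := ub m; have := sqrt_bound_le Nk; lra.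
  move: lt; rewrite ltr_pdivlMr; last by have := nrm_ge0 ip h; lra.
  by have := sqrt_bound_le km; have := nrm_ge0 ip h; nra.
exists N => m k Nm Nk; case: (leqP k m) => [|/ltnW] km; first exact: key.
by rewrite normsqB //; exact: key.
Qed.

(* [Y = 1 - sqrt (1 - X)] is the limit of the iteration. *)
Lemma one_minus_sqrt : exists Y : {linear H -> H},
  [/\ forall h, normsq (Y h) <= normsq h,
      forall h, 2%:R *: Y h = X h + Y (Y h) &
      forall (B : {linear H -> H}) C, (forall h, normsq (B h) <= C * normsq h) ->
        (forall h, B (X h) = X (B h)) -> forall h, B (Y h) = Y (B h)].
Proof.
have [Y Ylim] := choice (fun h => ip_complete hH (sqrt_iter_cauchy h)).
have YL : linear Y.
  move=> a x y; apply: (converges_unique hH (Ylim _)).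
  under eq_fun do rewrite linearP.
  exact: (convergesD hH (convergesZ hH a (Ylim x)) (Ylim y)).
have Yle1 h : nrm (Y h) <= nrm h.
  apply: (converges_nrm_le hH _ (Ylim h)) => m.
  apply: le_trans (sqrt_iter_le m h) _.
  by have /andP[] := sqrt_bound_itv m; have := nrm_ge0 ip h; nra.
exists (mklinear YL); split => /= [h|h|B C BC BX h].
- by rewrite -[normsq h]mul1r -(expr1n _ 2); apply: nrm_le_normsq => //; rewrite mul1r.
(* Split Y_m Y_m h - Y Y h as Y_m (Y_m h - Y h) + (Y_m - Y)(Y h), where Y_m is a contraction. *)
- have lim2 : converges (fun m => sqrt_iter m (sqrt_iter m h)) (Y (Y h)).
    move=> e e0; have e4 : 0 < e / 4 by lra.
    have [N hN] := Ylim h _ e4; have [N' hN'] := Ylim (Y h) _ e4.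
    exists (maxn N N') => m; rewrite geq_max => /andP[/hN a /hN' b].
    have := normsqD_le hH (sqrt_iter m (sqrt_iter m h - Y h)) (sqrt_iter m (Y h) - Y (Y h)).
    rewrite linearB /= addrA subrK.
    suff : normsq (sqrt_iter m (sqrt_iter m h - Y h)) <= normsq (sqrt_iter m h - Y h).
      by rewrite linearB /=; lra.
    rewrite -[leRHS]mul1r -(expr1n _ 2); apply: nrm_le_normsq => //; rewrite mul1r.
    apply: le_trans (sqrt_iter_le m _) _.
    by have /andP[] := sqrt_bound_itv m; have := nrm_ge0 ip (sqrt_iter m h - Y h); nra.
  have limS : converges (fun m => sqrt_iter m.+1 h) (Y h).
    by move=> e /(Ylim h)[N hN]; exists N => m Nm; apply: hN; apply: leqW.
  have limX := convergesD hH (converges_cst hH (X h)) lim2.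
  have := converges_unique hH limS (convergesZ hH (2^-1)%:C limX).
  have two_inv : 2%:R * (2^-1)%:C = 1 :> R[i].
    have -> : 2%:R = (2%:R)%:C by rewrite rmorph_nat.
    by rewrite -rmorphM /= divff ?rmorph1 // pnatr_eq0.
  by move=> Yh; rewrite [in LHS]Yh scalerA two_inv scale1r.
- apply: (converges_unique hH (converges_bounded hH BC (Ylim h))).
  have -> : (fun m => B (sqrt_iter m h)) = sqrt_iter^~ (B h).
    by apply/funext => m; exact: sqrt_iter_comm.
  exact: Ylim.
Qed.

End SqrtIteration.

(** * Schur's lemma for self-adjoint contractions *)

Section Schur.
Variables (R : realType) (H : lmodType R[i]) (ip : H -> H -> R[i]).
Hypothesis hH : is_hilbert ip.
Local Notation "r %:C" := (real_complex R r) : ring_scope.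
Local Notation normsq := (normsq ip).
Local Notation re := (re_ip ip).
Variables (I : Type) (p : I -> {linear H -> H}).
Hypothesis p_le : forall x h, normsq (p x h) <= normsq h.
Hypothesis p_irr : forall S : H -> Prop, is_subspace S -> is_closed ip S ->
  (forall x h, S h -> S (p x h)) -> (forall h, S h -> h = 0) \/ (forall h, S h).

(** The kernel of a bounded operator in the commutant is a closed invariant subspace. *)
Lemma commutant_ker (F : {linear H -> H}) C :
  (forall h, normsq (F h) <= C * normsq h) -> (forall x h, p x (F h) = F (p x h)) ->
  (forall h, F h = 0 -> h = 0) \/ (forall h, F h = 0).
Proof.
move=> FC Fp; apply: (p_irr (S := fun h => F h = 0)).
- split=> [|a x y Fx Fy]; first exact: linear0.
  by rewrite linearP Fx Fy scaler0 addr0.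
- move=> u l Fu ul; apply: (converges_unique hH (converges_bounded hH FC ul)).
  have -> : (fun m => F (u m)) = (fun=> 0) by apply/funext => m; exact: Fu.
  exact: converges_cst.
- by move=> x h Fh; rewrite -Fp Fh linear0.
Qed.

(* With [S = sqrt (T^2)], the product [(S - T)(S + T)] vanishes. *)
Lemma commutant_sign (T : {linear H -> H}) :
  (forall x y, ip (T x) y = ip x (T y)) -> (forall h, normsq (T h) <= normsq h) ->
  (forall x h, p x (T h) = T (p x h)) ->
  (forall h, 0 <= re (T h) h) \/ (forall h, re (T h) h <= 0).
Proof.
move=> Tsa Tle Tp.
have XL : linear (fun h => h - T (T h)).
  move=> a x y; rewrite !(linearP T); apply: (ip_ext hH) => z.
  by rewrite !(ipE hH); ring.
pose X := mklinear XL.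
(* |X h|^2 = |h|^2 - 2 |T h|^2 + |T T h|^2, and the last term is at most |T h|^2. *)
have X_le h : normsq (X h) <= normsq h.
  have := Tle (T h); have := Tle h.
  rewrite /= !normsqE !(reE hH) (re_sym hH (T (T h)) h).
  have -> : re h (T (T h)) = re (T h) (T h) by rewrite /re_ip Tsa.
  by have := normsq_ge0 hH (T h); rewrite normsqE; lra.
have [Y [Yle Yeq Ycomm]] := one_minus_sqrt hH X_le.
have Yp x h : p x (Y h) = Y (p x h).
  apply: (Ycomm (p x) 1) => [g|g] /=; first by rewrite mul1r.
  by rewrite linearB /= !Tp.
have YT h : T (Y h) = Y (T h).
  by apply: (Ycomm T 1) => [g|g] /=; [rewrite mul1r | rewrite linearB].
have Spos h : 0 <= re (h - Y h) h.
  have := re_le_nrm hH (Y h) h; have := normsq_le_nrm hH (Yle h).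
  rewrite !(reE hH) -normsqE -(nrm_sq hH); have := nrm_ge0 ip h; nra.
have SL : linear (fun h => h - Y h + T h).
  move=> a x y; rewrite !(linearP Y) !(linearP T); apply: (ip_ext hH) => z.
  by rewrite !(ipE hH); ring.
pose F := mklinear SL.
(* 10 = 2 (2 + 2) + 2, by two uses of [normsqD_le]. *)
have FC h : normsq (F h) <= 10%:R * normsq h.
  have := Tle h; have := Yle h; have := normsqD_le hH (h - Y h) (T h).
  have := normsqD_le hH h (- Y h); rewrite (normsqN hH) /=; lra.
have Fp x h : p x (F h) = F (p x h).
  by rewrite /= !linearD linearN /= Yp Tp.
have [F0|F0] := commutant_ker FC Fp; [left|right] => h.
- have STST : h - Y h - T h = 0.
    apply: F0; apply: (ip_ext hH) => z; rewrite (ip0l hH) /= !linearB /= -YT.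
    have := congr1 (ip ^~ z) (Yeq h); rewrite /= !(ipE hH) => e.
    by rewrite -[RHS](subrr (2 * ip (Y h) z)) {1}e; ring.
  by have := Spos h; rewrite (subr0_eq STST).
- have := Spos h; have -> : h - Y h = - T h.
    by apply/eqP; rewrite -addr_eq0; apply/eqP/F0.
  by rewrite (reNl hH) oppr_ge0.
Qed.

(** By [commutant_sign], A - c is semidefinite for each c in [-1, 1]. The supremum t of the c with A
    >= c then satisfies both A >= t and A <= t as quadratic forms, which forces A = t. *)
Lemma commutant_scalar (A : {linear H -> H}) :
  (forall x y, ip (A x) y = ip x (A y)) -> (forall h, normsq (A h) <= normsq h) ->
  (forall x h, p x (A h) = A (p x h)) ->
  exists t : R, forall h, A h = t%:C *: h.
Proof.
move=> Asa Ale Ap.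
have reAle h : `|re (A h) h| <= normsq h.
  rewrite -(@ler_pXn2r _ 2) ?nnegrE ?normr_ge0 ?normsq_ge0 // real_normK ?num_real //.
  apply: le_trans (cauchy_schwarz hH _ _) _; rewrite expr2.
  by apply: ler_wpM2r; rewrite ?normsq_ge0.
have sign c : -1 <= c <= 1 ->
    (forall h, c * normsq h <= re (A h) h) \/ (forall h, re (A h) h <= c * normsq h).
  move=> c1.
  (* Halving turns A - c, of norm at most 2, into a contraction. *)
  have TL : linear (fun h => (2^-1)%:C *: (A h - c%:C *: h)).
    move=> a x y; rewrite !(linearP A); apply: (ip_ext hH) => z.
    by rewrite !(ipE hH); ring.
  have [||x h|sgn|sgn] := @commutant_sign (mklinear TL).
  - move=> x y /=.
    rewrite (ipZl hH) (ipZr hH) conjc_real (ipDl hH) (ipDr hH) Asa; congr (_ * (_ + _)).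
    by rewrite (ipNl hH) (ipNr hH) (ipZl hH) (ipZr hH) conjc_real.
  - move=> h /=; rewrite (normsqZ hH).
    have := normsqD_le hH (A h) (- (c%:C *: h)); rewrite (normsqN hH) (normsqZ hH).
    have : c ^+ 2 <= 1 by nra.
    have := Ale h; have := normsq_ge0 hH h; nra.
  - by rewrite /= linearZ linearB /= linearZ /= Ap.
  - by left=> h; have := sgn h; rewrite /= !(reE hH) -normsqE; lra.
  - by right=> h; have := sgn h; rewrite /= !(reE hH) -normsqE; lra.
pose E := [set c : R | -1 <= c <= 1 /\ forall h, c * normsq h <= re (A h) h]%classic.
have supE : has_sup E.
  split; last by exists 1 => c [/andP[]].
  exists (-1); split=> [|h]; first by lra.
  by have := reAle h; rewrite ler_norml mulN1r => /andP[].
have ub c : E c -> c <= sup E by exact: sup_upper_bound.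
set t := sup E in ub.
have lower h : t * normsq h <= re (A h) h.
  rewrite -subr_le0; apply: le_eps0 => e e0.
  have d0 : 0 < e / (normsq h + 1) by rewrite divr_gt0 //; have := normsq_ge0 hH h; lra.
  have [c [c1 cA]] := sup_adherent d0 supE; rewrite -/t ltrBlDr -ltrBlDl => tc.
  move: tc; rewrite ltr_pdivlMr; last by have := normsq_ge0 hH h; lra.
  have := ub c (conj c1 cA); have := cA h; have := normsq_ge0 hH h; nra.
have t_itv : -1 <= t <= 1.
  apply/andP; split; last by apply: ge_sup => [|c [/andP[]]//]; case: supE.
  by apply: ub; split=> [|h]; [lra | have := reAle h; rewrite ler_norml mulN1r => /andP[]].
have upper h : re (A h) h <= t * normsq h.
  have [t1|t1] := leP 1 t.
    apply: le_trans (ler_norm _) (le_trans (reAle h) _).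
    by have := normsq_ge0 hH h; nra.
  rewrite -subr_le0; apply: le_eps0 => e e0.
  have d0 : 0 < e / (normsq h + 1) by rewrite divr_gt0 //; have := normsq_ge0 hH h; lra.
  (* The cap at 1 keeps c in the range of [sign]; as c > t, the alternative A >= c is excluded. *)
  pose c := Num.min 1 (t + e / (normsq h + 1)).
  have tc : t < c by rewrite lt_min t1 ltrDl.
  have c1 : -1 <= c <= 1 by rewrite ge_min lexx andbT; move: t_itv tc => /andP[? ?]; lra.
  have [cA|/(_ h) cA] := sign c c1; first by have := ub c (conj c1 cA); lra.
  have : c - t <= e / (normsq h + 1) by rewrite lerBlDl ge_min lexx orbT.
  rewrite ler_pdivlMr; last by have := normsq_ge0 hH h; lra.
  have := normsq_ge0 hH h; nra.
pose D x := A x - t%:C *: x.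
have D0 x : re (D x) x = 0.
  by apply/le_anti; rewrite /D !(reE hH) -normsqE subr_le0 subr_ge0 lower upper.
have Dsa x y : re (D x) y = re (D y) x.
  rewrite /D !(reE hH) (re_sym hH y x); congr (_ - _).
  by rewrite (re_sym hH (A y)) /re_ip Asa.
exists t => h; apply/subr0_eq/(normsq_eq0 hH); rewrite normsqE -/(D h).
(* Since D is symmetric with zero quadratic form, its value at h + D h reads 2 |D h|^2 = 0. *)
have := D0 (h + D h).
have -> : D (h + D h) = D h + D (D h).
  by apply: (ip_ext hH) => z; rewrite /D linearD !(ipE hH); ring.
by rewrite (reDl hH (D h)) !(reDr hH h (D h)) !D0 (Dsa (D h) h); lra.
Qed.

End Schur.

(** * Representations of C^*(Q_n) *)

Lemma sum_cls_flipo n (V : nmodType) (F : 'I_(2 ^ n) -> V) b (k : 'I_n) :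
  \sum_(y | cls y == ~~ b) F y = \sum_(x | cls x == b) F (flipo x k).
Proof.
rewrite (reindex_inj (inv_inj (flipoK k))) /=; apply: eq_bigl => x.
by rewrite cls_flipo (inj_eq negb_inj).
Qed.

Lemma sum_adj n (V : nmodType) (F : 'I_(2 ^ n) -> V) x :
  (forall y, ~~ adj x y -> cls y = ~~ cls x -> F y = 0) ->
  \sum_(y | cls y == ~~ cls x) F y = \sum_(k < n) F (flipo x k).
Proof.
move=> F0; rewrite (bigID (adj x)) /= [W in _ + W]big1 ?addr0; last first.
  by move=> y /andP[/eqP cy nxy]; exact: F0.
rewrite -(big_imset _ (in2W (@flipo_inj n x))) /=; apply: eq_bigl => y.
apply/andP/imsetP => [[_ /adjP[k ->]]|[k _ ->]]; first by exists k.
by rewrite cls_flipo eqxx; split=> //; apply/adjP; exists k.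
Qed.

(** * The flip operators X_k, their relations and the scalars t_k *)

Section QnRep.
Variables (R : realType) (n : nat) (H : lmodType R[i]) (ip : H -> H -> R[i]).
Hypothesis hH : is_hilbert ip.
Local Notation "r %:C" := (real_complex R r) : ring_scope.
Local Notation normsq := (normsq ip).
Variable p : 'I_(2 ^ n) -> {linear H -> H}.
Implicit Types (x y z : 'I_(2 ^ n)) (k l : 'I_n) (b : bool) (g h : H).
Hypothesis p_idem : forall x h, p x (p x h) = p x h.
Hypothesis p_sa : forall x h g, ip (p x h) g = ip h (p x g).
Hypothesis p_sum : forall b h, \sum_(x | cls x == b) p x h = h.
Hypothesis p_nonadj : forall x y h, cls x != cls y -> ~~ adj x y -> p x (p y h) = 0.

Lemma normsq_p x h : normsq (p x h) = re_ip ip (p x h) h.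
Proof. by rewrite /Defs.normsq p_sa p_idem -p_sa. Qed.

Lemma p_le x h : normsq (p x h) <= normsq h.
Proof.
have := normsq_ge0 hH (h - p x h).
by rewrite normsqE !(reE hH) (re_sym hH h) -normsq_p -!normsqE; lra.
Qed.

(** The projections of one side sum to 1, so |g|^2 is the sum of the |p_z g|^2; the term z = y
    already equals |g|^2. *)
Lemma p_orth x y h : x != y -> cls x = cls y -> p x (p y h) = 0.
Proof.
move=> xy cxy; set g := p y h.
have : normsq g = \sum_(z | cls z == cls y) normsq (p z g).
  rewrite normsqE -{1}(p_sum (cls y) g) (re_suml hH).
  by apply: eq_bigr => z _; rewrite normsq_p.
rewrite (bigD1 y) //= [in normsq (p y g)]p_idem -/g.
move=> /(congr1 (fun r => r - normsq g)); rewrite subrr addrAC subrr add0r.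
move=> /esym/psumr_eq0P e; apply: (normsq_eq0 hH).
by apply: e => [z _|]; [exact: normsq_ge0 | rewrite cxy eqxx].
Qed.

(** [flip_op false k] is X_k and [flip_op true k] is its adjoint; the parameter [b] lets one proof
    serve both. *)
Definition flip_op b k h : H := \sum_(x | cls x == b) p (flipo x k) (p x h).

Lemma flip_op_linear b k : linear (flip_op b k).
Proof.
move=> a x y; rewrite /flip_op scaler_sumr -big_split /=; apply: eq_bigr => z _.
by rewrite !linearP.
Qed.

HB.instance Definition _ b k :=
  @GRing.isLinear.Build _ _ _ _ (flip_op b k) (flip_op_linear b k).

Lemma flip_op_adjoint b k h g : ip (flip_op b k h) g = ip h (flip_op (~~ b) k g).
Proof.
rewrite /flip_op (sum_cls_flipo _ b k) (ip_suml hH) (ip_sumr hH); apply: eq_bigr => x _.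
by rewrite flipoK !p_sa.
Qed.

Lemma flip_op_p b k x h : cls x = b -> flip_op b k (p x h) = p (flipo x k) (p x h).
Proof.
move=> cx; rewrite /flip_op (bigD1 x) ?cx //= p_idem big1 ?addr0 // => y /andP[/eqP cy yx].
by rewrite (p_orth _ yx) ?linear0 // cx.
Qed.

Lemma p_flip_op b k x h : cls x = b -> p (flipo x k) (flip_op b k h) = p (flipo x k) (p x h).
Proof.
move=> cx; rewrite /flip_op linear_sum (bigD1 x) ?cx //= p_idem big1 ?addr0 // => y /andP[/eqP cy yx].
rewrite p_orth ?cls_flipo ?cx ?cy //.
by rewrite eq_sym (inj_eq (inv_inj (flipoK k))).
Qed.

(** For fixed x, the p_{x#k} p_x are the only possibly nonzero p_y p_x with y on the opposite side,
    and these sum to p_x. *)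
Lemma flip_op_sum b h : \sum_(k < n) flip_op b k h = h.
Proof.
rewrite exchange_big /= -[RHS](p_sum b); apply: eq_bigr => x /eqP cx.
rewrite -(sum_adj (F := fun y => p y (p x h))) => [|y nxy cy]; first exact: p_sum.
by rewrite p_nonadj // 1?adj_sym // cy; case: cls.
Qed.

(** The vertices x and w are opposite corners of a square, and p_x p_w = 0. Inserting 1 as the sum
    over the other side leaves only their two common neighbours. *)
Lemma square_relation x k l h : k != l -> let w := flipo (flipo x k) l in
  p x (p (flipo x k) (p w h)) + p x (p (flipo x l) (p w h)) = 0.
Proof.
move=> kl w; have xw : x != w.
  apply: contra kl => /eqP xw; apply/eqP/(@flipo_inj _ (flipo x k)).
  by rewrite flipoK [LHS]xw.
have := p_sum (~~ cls x) (p w h) => /(congr1 (p x)).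
rewrite p_orth // ?cls_flipo ?negbK // linear_sum (bigD1 (flipo x k)) ?cls_flipo //=.
rewrite (bigD1 (flipo x l)) /=; last by rewrite cls_flipo eqxx (inj_eq (@flipo_inj _ x)) eq_sym.
rewrite big1 ?addr0 ?addrA ?addr0 // => y /andP[/andP[/eqP cy yk] yl].
have [xy|nxy] := boolP (adj x y); last by rewrite p_nonadj // cy; case: cls.
rewrite (p_nonadj (y := w)) ?linear0 //; first by rewrite cy !cls_flipo; case: cls.
by apply/negP => yw; have := common_nbr kl xy yw; rewrite (negbTE yk) (negbTE yl).
Qed.

(** A sum over two-step paths, so that exchanging k and l compares the two ways around a square. *)
Lemma flip_op2E b k l h :
  flip_op (~~ b) k (flip_op b l h) =
    \sum_(x | cls x == b) p x (p (flipo x k) (p (flipo (flipo x k) l) h)).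
Proof.
rewrite {1}/flip_op (sum_cls_flipo _ b k); apply: eq_bigr => x /eqP cx.
rewrite flipoK -{1}(flipoK l (flipo x k)) p_flip_op ?flipoK //.
by rewrite !cls_flipo negbK.
Qed.

Lemma flip_op_anti b k l h : k != l ->
  flip_op (~~ b) k (flip_op b l h) = - flip_op (~~ b) l (flip_op b k h).
Proof.
move=> kl; apply/eqP; rewrite -addr_eq0 !flip_op2E -big_split /= big1 // => x _.
by rewrite [flipo (flipo x l) k]flipoC square_relation.
Qed.

Definition central_op b k h := flip_op (~~ b) k (flip_op b k h).

(** X_k is the sum over l of X_l^* X_k, and X_k^* that of X_k^* X_l. The terms with l <> k cancel in
    pairs and the two diagonal terms agree. *)
Lemma flip_op_real_part b k h : flip_op b k h + flip_op (~~ b) k h = 2%:R *: central_op b k h.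
Proof.
have e1 : flip_op b k h = central_op b k h + \sum_(l | l != k) flip_op (~~ b) l (flip_op b k h).
  by rewrite -[LHS](flip_op_sum (~~ b)) (bigD1 k).
have e2 : flip_op (~~ b) k h = central_op b k h + \sum_(l | l != k) flip_op (~~ b) k (flip_op b l h).
  by rewrite -[in LHS](flip_op_sum b h) linear_sum (bigD1 k).
rewrite [LHS](congr2 +%R e1 e2) addrACA scaler_nat mulr2n.
rewrite -[W in _ + W]big_split /= [W in _ + W]big1 ?addr0 // => l lk.
by rewrite flip_op_anti // addNr.
Qed.

(** The left side of [flip_op_real_part] is symmetric under exchange of the two sides, so X_k is
    normal. *)
Lemma central_op_indep b k h : central_op (~~ b) k h = central_op b k h.
Proof.
have two0 : (2%:R : R[i]) != 0 by rewrite pnatr_eq0.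
by apply: (scalerI two0); rewrite -!flip_op_real_part negbK addrC.
Qed.

Lemma central_op_p b k x h : p x (central_op b k h) = central_op b k (p x h).
Proof.
(* By [central_op_indep] the side may be taken to be that of x; the two flips then lead to x#k and
   back. *)
wlog cx : b / cls x = b.
  move=> th; have [/th//|cx] := eqVneq (cls x) b.
  by rewrite -![central_op b _ _]central_op_indep; apply: th; case: b cx; case: cls.
rewrite /central_op flip_op_p // -(flipoK k x) p_flip_op ?cls_flipo ?cx // flipoK p_flip_op //.
by rewrite [in RHS]flip_op_p ?cls_flipo ?cx // flipoK.
Qed.

Lemma central_op_sum b h : \sum_(k < n) central_op b k h = h.
Proof.
have two0 : (2%:R : R[i]) != 0 by rewrite pnatr_eq0.
apply: (scalerI two0); rewrite scaler_sumr.
under eq_bigr do rewrite -flip_op_real_part.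
by rewrite big_split /= !flip_op_sum scaler_nat mulr2n.
Qed.

Lemma central_op_adjoint b k h g : ip (central_op b k h) g = ip h (central_op b k g).
Proof. by rewrite /central_op !flip_op_adjoint negbK. Qed.

Lemma normsq_flip_op b k h : normsq (flip_op b k h) = re_ip ip (central_op b k h) h.
Proof. by rewrite /Defs.normsq flip_op_adjoint /re_ip -central_op_adjoint. Qed.

(** The X_l^* X_l sum to 1, so |h|^2 is the sum of the |X_l h|^2. *)
Lemma flip_op_le b k h : normsq (flip_op b k h) <= normsq h.
Proof.
have -> : normsq h = \sum_l normsq (flip_op b l h).
  by under eq_bigr do rewrite normsq_flip_op; rewrite -(re_suml hH) central_op_sum.
by rewrite (bigD1 k) //= lerDl sumr_ge0 // => l _; exact: normsq_ge0.
Qed.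

Lemma central_op_linear b k : linear (central_op b k).
Proof. by move=> a x y; rewrite /central_op !linearP. Qed.

Hypothesis p_irr : forall S : H -> Prop, is_subspace S -> is_closed ip S ->
  (forall x h, S h -> S (p x h)) -> (forall h, S h -> h = 0) \/ (forall h, S h).

Lemma central_op_scalar (h0 : H) : h0 <> 0 -> exists t : 'I_n -> R,
  [/\ forall k, 0 <= t k, \sum_k t k = 1 & forall b k h, central_op b k h = (t k)%:C *: h].
Proof.
move=> h0n0.
have h0p : 0 < normsq h0.
  rewrite lt_def normsq_ge0 // andbT; apply: contra_notN h0n0 => /eqP.
  exact: normsq_eq0.
have /choice[t tE] : forall k, exists r : R, forall h, central_op false k h = r%:C *: h.
  move=> k.
  apply: (@commutant_scalar _ _ _ hH _ p p_le p_irr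
           (mklinear (central_op_linear false k))) => [x y|h|x h] /=.
  - exact: central_op_adjoint.
  - exact: le_trans (flip_op_le _ _ _) (flip_op_le _ _ _).
  - exact: central_op_p.
have tZ b k h : central_op b k h = (t k)%:C *: h.
  by rewrite -tE; case: b => //; rewrite -(central_op_indep true).
exists t; split=> // [k|].
  have := normsq_ge0 hH (flip_op false k h0).
  by rewrite normsq_flip_op tZ !(reE hH) -normsqE pmulr_lge0.
have := congr1 (re_ip ip ^~ h0) (central_op_sum false h0); rewrite (re_suml hH) => e.
apply: (mulIf (lt0r_neq0 h0p)); rewrite mul1r normsqE -[RHS]e mulr_suml.
by apply: eq_bigr => k _; rewrite tZ !(reE hH).
Qed.

(** * Clifford normalisation and fixed families *)

Variable t : 'I_n -> R.
Hypothesis t_ge0 : forall k, 0 <= t k.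
Hypothesis Zt : forall b k h, central_op b k h = (t k)%:C *: h.

Lemma normsq_flip_op_scalar b k h : normsq (flip_op b k h) = t k * normsq h.
Proof. by rewrite normsq_flip_op Zt !(reE hH). Qed.

(* On vectors at the vertex [x], these are anticommuting operators of square [-1]. *)
Definition dflip k x g : H := ((-1) ^+ cls x * (Num.sqrt (t k))^-1)%:C *: flip_op (cls x) k g.

Lemma dflipZ k x (a : R) g : dflip k x (a%:C *: g) = a%:C *: dflip k x g.
Proof. by rewrite /dflip linearZ /= !scalerA mulrC. Qed.

Lemma dflipD k x g h : dflip k x (g + h) = dflip k x g + dflip k x h.
Proof. by rewrite /dflip linearD scalerDr. Qed.

Lemma dflip_sq k x g : t k != 0 -> dflip k (flipo x k) (dflip k x g) = - g.
Proof.
move=> tk; rewrite /dflip linearZ /= cls_flipo scalerA -/(central_op _ _ _) Zt scalerA -!rmorphM /=.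
have s2 : (Num.sqrt (t k))^-1 ^+ 2 * t k = 1.
  by rewrite exprVn sqr_sqrtr // mulVf.
have -> : (-1) ^+ (~~ cls x) / Num.sqrt (t k) * ((-1) ^+ cls x / Num.sqrt (t k)) * t k =
   ((-1) ^+ (~~ cls x) * (-1) ^+ cls x) * ((Num.sqrt (t k))^-1 ^+ 2 * t k) by ring.
rewrite s2 mulr1 -signr_addb addNb addbb rmorphN rmorph1 scaleN1r //.
Qed.

Lemma dflip_anti k l x g : k != l ->
  dflip k (flipo x l) (dflip l x g) = - dflip l (flipo x k) (dflip k x g).
Proof.
move=> kl; rewrite /dflip !linearZ /= !cls_flipo flip_op_anti // scalerN !scalerN !scalerA.
by rewrite -!rmorphM /=; congr (- (_%:C *: _)); ring.
Qed.

Lemma p_dflip k x g : p x g = g -> p (flipo x k) (dflip k x g) = dflip k x g.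
Proof.
by move=> pg; rewrite /dflip linearZ /= p_flip_op // -[in RHS]pg flip_op_p.
Qed.

Lemma normsq_dflip k x g : t k != 0 -> normsq (dflip k x g) = normsq g.
Proof.
move=> tk; rewrite /dflip (normsqZ hH) normsq_flip_op_scalar exprMn sqrr_sign mul1r mulrA.
by rewrite exprVn sqr_sqrtr // mulVf // mul1r.
Qed.

(* Commuting involutions on families of vectors indexed by the vertices; their
   common fixed families transform under the [p x] like the basis of [rho_t]. *)
Definition Gamma k (f : 'I_(2 ^ n) -> H) x : H :=
  ((-1) ^+ par k (flipo x k))%:C *: dflip k (flipo x k) (f (flipo x k)).

Lemma GammaD k f1 f2 x : Gamma k (fun y => f1 y + f2 y) x = Gamma k f1 x + Gamma k f2 x.
Proof. by rewrite /Gamma dflipD scalerDr. Qed.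

Lemma Gamma_eq k f1 f2 : f1 =1 f2 -> Gamma k f1 =1 Gamma k f2.
Proof. by move=> f12 x; rewrite /Gamma f12. Qed.

(** The -1 of [dflip_sq] cancels against par_k(x#k) differing from par_k(x). *)
Lemma GammaK k f x : t k != 0 -> Gamma k (Gamma k f) x = f x.
Proof.
move=> tk; rewrite /Gamma flipoK dflipZ -{1}(flipoK k x) dflip_sq // flipoK scalerA.
rewrite -rmorphM /= -signr_addb par_flip leqnn addbT addNb addbb rmorphN rmorph1.
by rewrite scaleN1r opprK.
Qed.

(** For k <> l exactly one of k <= l and l <= k holds, so just one of the two parity signs changes
    under the other flip; this compensates the anticommutation in [dflip_anti]. *)
Lemma GammaC k l f x : Gamma k (Gamma l f) x = Gamma l (Gamma k f) x.
Proof.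
have [->//|kl] := eqVneq k l.
rewrite /Gamma (dflipZ k) (dflipZ l) [flipo (flipo x l) k]flipoC.
set y := flipo (flipo x k) l.
have -> : flipo x k = flipo y l by rewrite flipoK.
have -> : flipo x l = flipo y k by rewrite /y flipoC flipoK.
rewrite dflip_anti //; move: (dflip l _ _) => v.
rewrite !scalerN !scalerA -scaleNr -!rmorphM -rmorphN /=; congr (_%:C *: _).
have : (k : nat) != l by [].
rewrite !par_flip !leqnn; case: (ltngtP k l) => // _ _;
  by case: (par k x); case: (par l x); rewrite /=; ring.
Qed.
(** The subcube through x0 in the directions of s: the support of the family averaged over these
    directions. *)
Definition reachable (s : seq 'I_n) x0 x : bool :=
  [forall k : 'I_n, (k \in s) || (bit k x == bit k x0)].

Lemma reachable_refl s x : reachable s x x.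
Proof. by apply/forallP => k; rewrite eqxx orbT. Qed.

Lemma reachable_cons_eq s k x0 x : bit k x = bit k x0 ->
  reachable (k :: s) x0 x = reachable s x0 x.
Proof.
move=> e; apply: eq_forallb => l; rewrite inE.
by have [->|] := eqVneq l k; rewrite // e eqxx !orbT.
Qed.

Lemma reachable_cons_neq s k x0 x : bit k x != bit k x0 ->
  reachable (k :: s) x0 x = reachable s x0 (flipo x k).
Proof.
move=> e; apply: eq_forallb => l; rewrite inE /= bit_flip (inj_eq val_inj).
have [->|] := eqVneq l k; last by rewrite addbF.
by rewrite addbT; move: e; case: (bit k x); case: (bit k x0); rewrite ?orbT.
Qed.

Lemma not_reachable s k x0 x : k \notin s -> bit k x != bit k x0 -> reachable s x0 x = false.
Proof. by move=> ks e; apply/forallP => /(_ k); rewrite (negbTE ks) (negbTE e). Qed.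

(** Induction on s, replacing f by f + Gamma_k f: it is fixed by the involution Gamma_k, and by the
    earlier ones because they commute. Norms stay 0 or 1, as the two summands live at vertices with
    different k-th digits. *)
Lemma Gamma_fixed_family (s : seq 'I_n) x0 h0 : uniq s -> {in s, forall k, t k != 0} ->
  p x0 h0 = h0 -> normsq h0 = 1 ->
  exists f : 'I_(2 ^ n) -> H, [/\ forall x, p x (f x) = f x,
    forall x, normsq (f x) = (reachable s x0 x)%:R &
    forall k x, k \in s -> Gamma k f x = f x].
Proof.
move=> us ts ph0 nh0; elim: s us ts => [|k s IH] /=.
  move=> _ _; exists (fun x => if x == x0 then h0 else 0); split=> // x.
    by case: eqP => [->|]; rewrite ?ph0 ?linear0.
  have -> : reachable [::] x0 x = (x == x0).
    apply/forallP/eqP => [e|-> k]; last by rewrite eqxx.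
    apply/val_inj/bit_inj => l; case: (ltnP l n) => ln.
      by apply/eqP; have := e (Ordinal ln).
    have big y : bit l y = false.
      by rewrite /bit divn_small // (leq_trans (ltn_ord y)) // leq_exp2l.
    by rewrite !big.
  by case: eqP; rewrite ?nh0 // /Defs.normsq (ip0l hH).
move=> /andP[ks us] ts.
have [|f [pf nf Gf]] := IH us; first by move=> l ls; apply: ts; rewrite inE ls orbT.
have tk : t k != 0 by apply: ts; rewrite inE eqxx.
have f0 x : reachable s x0 x = false -> f x = 0.
  by move=> rx; apply: (normsq_eq0 hH); rewrite nf rx.
exists (fun x => f x + Gamma k f x); split=> [x|x|l x].
- rewrite linearD pf /Gamma linearZ /=; congr (_ + _ *: _).
  by rewrite -[in p _](flipoK k x) p_dflip.
- have [e|e] := eqVneq (bit k x) (bit k x0).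
    rewrite reachable_cons_eq // /Gamma (f0 (flipo x k)); last first.
      by apply: (not_reachable ks); rewrite /= bit_flip eqxx addbT e; case: bit.
    by rewrite /dflip linear0 !scaler0 addr0 nf.
  rewrite reachable_cons_neq // f0 ?add0r; last exact: not_reachable e.
  by rewrite /Gamma (normsqZ hH) sqrr_sign mul1r normsq_dflip.
- rewrite inE GammaD => /orP[/eqP ->|ls]; first by rewrite GammaK // addrC.
  by rewrite Gf // GammaC (Gamma_eq k (f2 := f)) // => y; exact: Gf.
Qed.

(** * Vectors transforming by the coefficients c_t *)

Lemma ct_flipo x k : ct t x (flipo x k) = ((-1) ^+ par k x * Num.sqrt (t k))%:C.
Proof.
rewrite /ct; case: pickP => [l /eqP/flip_inj/val_inj <-|/(_ k)]; last by rewrite eqxx.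
by rewrite rmorphM rmorphXn rmorphN rmorph1.
Qed.

Lemma ct_nonadj x y : ~~ adj x y -> ct t x y = 0.
Proof.
move=> nxy; rewrite /ct; case: pickP => // k /eqP e.
by case/negP: nxy; apply/existsP; exists k; apply/eqP.
Qed.

Lemma conjc_ct x y : conjc (ct t x y) = ct t x y.
Proof.
have [/adjP[k ->]|/ct_nonadj ->] := boolP (adj x y); last exact: conjc0.
by rewrite ct_flipo conjc_real.
Qed.

(** Take the family fixed by all Gamma_k with t_k <> 0: its fixed-point equations say that the k-th
    flip sends e_x to a multiple of e_{x#k}, with factor sqrt(t_k) up to the sign of c_t. *)
Lemma rho_basis x0 h0 : p x0 h0 = h0 -> normsq h0 = 1 ->
  exists e : 'I_(2 ^ n) -> H, [/\ forall x, p x (e x) = e x,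
    forall x, normsq (e x) = 1 \/ e x = 0, e x0 <> 0,
    forall u v, inU n u -> inV n v -> p v (e u) = ct t u v *: e v &
    forall u v, inU n u -> inV n v -> p u (e v) = ct t u v *: e u].
Proof.
move=> ph0 nh0.
have [||f [pf nf Gf]] :=
    @Gamma_fixed_family [seq k <- enum 'I_n | t k != 0] x0 h0 _ _ ph0 nh0.
- by rewrite filter_uniq ?enum_uniq.
- by move=> k; rewrite mem_filter => /andP[].
have Xf x k : flip_op (cls x) k (f x) =
    ((-1) ^+ cls x * (-1) ^+ par k x * Num.sqrt (t k))%:C *: f (flipo x k).
  (* For t_k = 0 both sides vanish, as the flip multiplies squared norms by t_k. *)
  have [tk0|tk] := eqVneq (t k) 0.
    rewrite tk0 sqrtr0 mulr0 scale0r; apply: (normsq_eq0 hH).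
    by rewrite normsq_flip_op_scalar tk0 mul0r.
  have ks : k \in [seq k <- enum 'I_n | t k != 0] by rewrite mem_filter tk mem_enum.
  rewrite -(Gf k (flipo x k) ks) /Gamma flipoK /dflip.
  rewrite !scalerA -!rmorphM /= -[LHS]scale1r; congr (_ *: _).
  have s0 : Num.sqrt (t k) != 0 by rewrite sqrtr_eq0 -ltNge lt_def tk t_ge0.
  rewrite -[LHS](rmorph1 (real_complex R)); congr (_%:C).
  by case: (cls x); case: (par k x); rewrite /=; field.
exists f; split=> //.
- by move=> x; have := nf x; case: reachable => [|/(normsq_eq0 hH)]; [left|right].
- move=> fx0; have := nf x0; rewrite fx0 reachable_refl /Defs.normsq (ip0l hH) /=.
  by move/esym/eqP; rewrite oner_eq0.
- move=> u v uU vV; have cu : cls u = false by exact: negbTE.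
  have cv : cls v = true by [].
  have [/adjP[k ->]|nuv] := boolP (adj u v).
    by rewrite ct_flipo -{1}(pf u) -(flip_op_p (b := cls u)) // pf Xf cu expr0 mul1r.
  by rewrite ct_nonadj // scale0r -(pf u) p_nonadj ?cu ?cv // adj_sym.
- move=> u v uU vV; have cu : cls u = false by exact: negbTE.
  have cv : cls v = true by [].
  have [/adjP[k vE]|nuv] := boolP (adj u v); last first.
    by rewrite ct_nonadj // scale0r -(pf v) p_nonadj ?cu ?cv.
  have uE : u = flipo v k by rewrite vE flipoK.
  (* The factor -1 on V_n turns the parity sign at v into that at u = v#k, the end from which c_t is
     read. *)
  rewrite {1}uE -{1}(pf v) -(flip_op_p (b := cls v)) // pf Xf -uE cv vE ct_flipo /= par_flip leqnn.
  by rewrite addbT expr1; congr (_%:C *: _); case: par; rewrite /=; ring.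
Qed.

Lemma sum_Ut (V : nmodType) (F : 'I_(2 ^ n) -> V) :
  \sum_(i : Ut n) F (val i) = \sum_(x | cls x == false) F x.
Proof.
rewrite [RHS](reindex_omap (val : Ut n -> _) insub) => [|x cx].
  apply: eq_bigl => i; rewrite valK eqxx andbT.
  by have := valP i; rewrite /inU /= -/(cls _) eqbF_neg => ->.
by rewrite insubT /=; first by rewrite /inU -/(cls x) -eqbF_neg.
Qed.

(** * Coordinates and the unitary equivalence *)

Section Basis.
Variable e : 'I_(2 ^ n) -> H.
Hypothesis pe : forall x, p x (e x) = e x.
Hypothesis ne : forall x, normsq (e x) = 1 \/ e x = 0.
Hypothesis peV : forall u v, inU n u -> inV n v -> p v (e u) = ct t u v *: e v.
Hypothesis peU : forall u v, inU n u -> inV n v -> p u (e v) = ct t u v *: e u.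

Definition coordU h : vecU R n := fun i => ip h (e (val i)).

Lemma cls_Ut (i : Ut n) : cls (val i) = false.
Proof. exact: negbTE (valP i). Qed.

(** For x in V_n, p_x e_u = c_t(ux) e_x, and e_x is the sum of the p_u e_x = c_t(ux) e_u; this
    yields the rank-one matrix of [rho_t]. *)
Lemma coordU_p x h : coordU (p x h) = rho_t t x (coordU h).
Proof.
apply/funext => i; rewrite /rho_t /coordU p_sa; have iU := valP i.
case: ifPn => [xU|xV].
  case: eqP => [<-|/eqP ix]; first by rewrite pe.
  rewrite -(pe (val i)) p_orth ?(ip0r hH) //; first by rewrite eq_sym.
  by rewrite cls_Ut; exact: negbTE.
have {}xV : inV n x by rewrite -[inV n x]negbK.
rewrite peV // (ipZr hH) conjc_ct; congr (_ * _).
rewrite -[in LHS](p_sum false (e x)) -sum_Ut (ip_sumr hH); apply: eq_bigr => j _.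
by rewrite peU ?(ipZr hH) //; exact: valP.
Qed.

(** This is the orthogonal complement of the e_u; it is invariant because [coordU] intertwines [p]
    with [rho_t]. *)
Lemma coordU_eq0_closed_invariant : let S h := forall i, coordU h i = 0 in
  [/\ is_subspace S, is_closed ip S & forall x h, S h -> S (p x h)].
Proof.
split=> [|u l Su ul i|x h Sh i].
- split=> [i|a x y Sx Sy i]; first exact: (ip0l hH).
  by rewrite /coordU (ip_linear hH) [ip x _]Sx [ip y _]Sy mulr0 addr0.
- by apply: (converges_ip0 hH _ ul) => m; exact: Su.
- rewrite coordU_p /rho_t; case: ifP => _; first by case: ifP.
  by rewrite big1 ?mulr0 // => j _; rewrite Sh mulr0.
Qed.

Hypothesis e_total : forall h, (forall i, coordU h i = 0) -> h = 0.

Lemma rho_t_unitary_equiv : exists (W : vecU R n -> Prop) (T : H -> vecU R n),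
    (W (fun _ => 0) /\
     (forall (a : R[i]) f f', W f -> W f' -> W (fun i => a * f i + f' i))) /\
    (forall x f, W f -> W (rho_t t x f)) /\
    (forall (a : R[i]) h h', T (a *: h + h') = (fun i => a * T h i + T h' i)) /\
    (forall h h', ipU (T h) (T h') = ip h h') /\
    (forall h, W (T h)) /\ (forall f, W f -> exists h, T h = f) /\
    (forall x h, T (p x h) = rho_t t x (T h)).
Proof.
(* Some e_u may be 0; the range of [coordU] consists of the functions vanishing at those u. *)
pose W (f : vecU R n) := forall i : Ut n, e (val i) = 0 -> f i = 0.
have e_orth (i j : Ut n) : i != j -> ip (e (val i)) (e (val j)) = 0.
  by move=> ij; rewrite -(pe (val i)) p_sa -(pe (val j)) p_orth ?cls_Ut ?(ip0r hH).
have coordK (c : vecU R n) : W c -> coordU (\sum_i c i *: e (val i)) = c.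
  move=> Wc; apply/funext => j; rewrite /coordU (ip_suml hH) (bigD1 j) //= (ipZl hH) big1.
    rewrite addr0 (ip_selfE hH).
    by have [->|/Wc ->] := ne (val j); rewrite ?rmorph1 ?mulr1 ?mul0r.
  by move=> i ij; rewrite (ipZl hH) e_orth ?mulr0.
have WT h : W (coordU h) by move=> i ei; rewrite /coordU ei (ip0r hH).
have expand h : h = \sum_i coordU h i *: e (val i).
  apply/subr0_eq/e_total => j; have := congr1 (fun f => f j) (coordK _ (WT h)).
  by rewrite /coordU (ipDl hH) (ipNl hH) => ->; rewrite subrr.
have T_onto f : W f -> exists h, coordU h = f.
  by move=> /coordK <-; eexists.
exists W, coordU.
split; last split; last split; last split; last split; last split; rewrite //.
- by split=> [i|a f f' Wf Wf' i ei] //; rewrite Wf ?Wf' // mulr0 addr0.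
- by move=> x f /T_onto[h <-]; rewrite -coordU_p.
- by move=> a h h'; apply/funext => i; rewrite /coordU (ipDl hH) (ipZl hH).
- move=> h h'; rewrite [in RHS](expand h) (ip_suml hH) /ipU; apply: eq_bigr => i _.
  by rewrite (ipZl hH) -(ip_conj hH).
- exact: coordU_p.
Qed.

End Basis.
End QnRep.

Theorem theorem5p3 (R : realType) (n : nat) (hn : (1 <= n)%N)
    (H : lmodType R[i]) (ip : H -> H -> R[i]) (hH : is_hilbert ip)
    (p : 'I_(2 ^ n) -> H -> H)
    (hrep : is_QnRep ip p) (hirr : is_irreducible ip p) :
  exists t : 'I_n -> R,
    (forall k, 0 <= t k) /\ \sum_(k < n) t k = 1 /\
    exists (W : vecU R n -> Prop) (T : H -> vecU R n),
      (* W is an invariant subspace of C^{U_n} for rho_t *)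
      (W (fun _ => 0) /\
       (forall (a : R[i]) f g, W f -> W g -> W (fun i => a * f i + g i))) /\
      (forall x f, W f -> W (rho_t t x f)) /\
      (* T : H -> W is a unitary (linear, inner-product preserving, onto W) *)
      (forall (a : R[i]) h h', T (a *: h + h') = (fun i => a * T h i + T h' i)) /\
      (forall h h', ipU (T h) (T h') = ip h h') /\
      (forall h, W (T h)) /\ (forall f, W f -> exists h, T h = f) /\
      (* T intertwines rho and rho_t restricted to W *)
      (forall x h, T (p x h) = rho_t t x (T h)).
Proof.
case: hrep => pproj [psumU [psumV pUV]]; case: hirr => [[h0 h0n0] pirr].
pose P x := mklinear ((pproj x).1).
have P_idem x h : P x (P x h) = P x h by exact: (pproj x).2.1.
have P_sa x h g : ip (P x h) g = ip h (P x g) by exact: (pproj x).2.2.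
have P_sum b h : \sum_(x | cls x == b) P x h = h.
  case: b; first by rewrite -[RHS]psumV; apply: eq_bigl => x; rewrite eqb_id.
  by rewrite -[RHS]psumU; apply: eq_bigl => x; rewrite eqbF_neg.
have P_nonadj x y h : cls x != cls y -> ~~ adj x y -> P x (P y h) = 0.
  have [xV|xU] := boolP (inV n x) => cxy nxy; last first.
    by apply: pUV => //; move: cxy; rewrite /inV -!/(cls _) in xU *; rewrite (negbTE xU); case: cls.
  (* The relation is given with U_n on the left; taking adjoints yields the other order. *)
  apply: (ip_ext hH) => g; rewrite (ip0l hH) !P_sa.
  rewrite [P y _]pUV ?(ip0r hH) 1?adj_sym //.
  by move: cxy; rewrite /inU -/(cls _) [cls x]xV; case: cls.
have [t [t0 t1 Zt]] := central_op_scalar hH P_idem P_sa P_sum P_nonadj pirr h0n0.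
exists t; split=> //; split=> //.
(* Starting in U_n makes e_{x0} one of the vectors that define the coordinates. *)
have [x0 x0U px0] : exists2 x, inU n x & P x h0 <> 0.
  apply: contrapT => none; apply: h0n0; rewrite -(psumU h0) big1 // => x xU.
  by apply: contrapT => px; apply: none; exists x.
pose g := real_complex R (norm_ip ip (P x0 h0))^-1 *: P x0 h0.
have [||e [pe ne e0 peV peU]] := @rho_basis R n H ip hH P P_idem P_sa P_sum P_nonadj t t0 Zt x0 g.
- by rewrite /g linearZ [in LHS]P_idem.
- rewrite /g (normsqZ hH) exprVn (nrm_sq hH) mulVf //.
  by apply: contra_notN px0 => /eqP; exact: normsq_eq0.
apply: (rho_t_unitary_equiv hH P_idem P_sa P_sum pe ne peV peU).
have [Ssub Scl Sinv] := coordU_eq0_closed_invariant hH P_idem P_sa P_sum pe peV peU.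
have [//|all] := pirr _ Ssub Scl Sinv.
(* If all coordinates vanished identically, e_{x0} would be orthogonal to itself. *)
exfalso; apply: e0; apply: (normsq_eq0 hH).
by rewrite /normsq [ip _ _](all _ (exist _ x0 x0U)).
Qed.
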